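(* Suppose that $A_2$ and $B$ are simultaneously diagonalizable via congruence and that there exists $\bar{x}\in\mathbb{R}^n$ with $g(\bar{x})<0$. Then the following three statements are equivalent: (a) $f_2(x)>0$ for all $x\in X=\{x\in\mathbb{R}^n: g(x)\le 0\}$. (b) There exist $\delta>0$ and $\eta\ge 0$ such that $$\begin{pmatrix}A_2 & b_2\\ b_2^T & c_2-\delta\end{pmatrix}+\eta\begin{pmatrix}B & d\\ d^T & \alpha\end{pmatrix}\succeq 0.$$ (c) There exists $\delta>0$ such that $\inf_{x\in\mathbb{R}^n}\{f_2(x): g(x)\le 0\}\ge\delta>0$.
   Context: Let $f_2(x)=x^TA_2x+2b_2^Tx+c_2$ and $g(x)=x^TBx+2d^Tx+\alpha$ be functions on $\mathbb{R}^n$, where $A_2,B$ are real symmetric $n\times n$ matrices (possibly indefinite), $b_2,d\in\mathbb{R}^n$ and $c_2,\alpha\in\mathbb{R}$. The matrices $A_2$ and $B$ are simultaneously diagonalizable via congruence if there exists a nonsingular real matrix $C$ such that both $C^TA_2C$ and $C^TBC$ are diagonal. The notation $M\succeq 0$ means that the symmetric matrix $M$ is positive semidefinite. *)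

(* Defs.v *)
From mathcomp Require Import all_boot all_order all_algebra.
From mathcomp Require Import classical_sets reals constructive_ereal ereal.

Set Implicit Arguments.
Unset Strict Implicit.
Unset Printing Implicit Defensive.

Import Order.TTheory GRing.Theory Num.Theory.
Local Open Scope ring_scope.

(* x^T A x + 2 b^T x + c; the 1 x 1 products are read as scalars. *)
Definition quadfun (R : realType) (n : nat)
    (A : 'M[R]_n) (b : 'cV[R]_n) (c : R) (x : 'cV[R]_n) : R :=
  (x^T *m A *m x) 0 0 + 2 * (b^T *m x) 0 0 + c.

Definition psdmx (R : realType) (m : nat) (M : 'M[R]_m) : Prop :=
  M \is symmetricmx /\ forall z : 'cV[R]_m, 0 <= (z^T *m M *m z) 0 0.

Definition sim_diag_congr (R : realType) (n : nat) (A B : 'M[R]_n) : Prop :=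
  exists C : 'M[R]_n, [/\ C \in unitmx,
    is_diag_mx (C^T *m A *m C) & is_diag_mx (C^T *m B *m C)].

Definition bordermx (R : realType) (n : nat)
    (A : 'M[R]_n) (b : 'cV[R]_n) (c : R) : 'M[R]_(n + 1) :=
  block_mx A b b^T c%:M.

(* Main.v *)
Require Import Defs.
From mathcomp Require Import all_boot all_order all_algebra ring lra.
From mathcomp Require Import boolp classical_sets reals constructive_ereal ereal.

Import Order.TTheory GRing.Theory Num.Theory.
Local Open Scope classical_set_scope.
Local Open Scope ring_scope.

(** After the congruence, f2 and g are sums of one-variable quadratics.  For such
    a pair the set of values (f2, g) enlarged by the positive quadrant is convex,
    coordinate by coordinate, so a separation argument gives eta >= 0 with
    h = f2 + eta g >= 0 everywhere.  If min h > 0 we are done.  Otherwise h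
    vanishes on a nonempty flat M, where f2 = - eta g; (a) and convexity force g
    to have a constant strict sign on M, and a diagonal quadratic that is positive
    on M is bounded away from 0 there.  Moving eta slightly in the direction of
    that sign gains a first-order amount on M and loses only a second-order amount
    in the coordinates transversal to M, so f2 + eta' g >= delta > 0. *)

(** * Separable quadratics *)

Definition sepquad {R : realType} {n : nat} (a b : 'I_n -> R) (c : R)
    (y : 'I_n -> R) : R :=
  \sum_i (a i * y i ^+ 2 + 2 * b i * y i) + c.

Lemma sepquadD {R : realType} {n : nat} (a b a' b' : 'I_n -> R) (c c' t : R)
    (y : 'I_n -> R) :
  sepquad (fun i => a i + t * a' i) (fun i => b i + t * b' i) (c + t * c') y
  = sepquad a b c y + t * sepquad a' b' c' y.
Proof.
rewrite /sepquad mulrDr mulr_sumr addrACA -big_split /=.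
by congr (_ + _); apply: eq_bigr => i _; ring.
Qed.

Lemma sepquadN {R : realType} {n : nat} (a b : 'I_n -> R) (c : R)
    (y : 'I_n -> R) :
  sepquad (fun i => - a i) (fun i => - b i) (- c) y = - sepquad a b c y.
Proof.
rewrite /sepquad opprD -sumrN.
by congr (_ + _); apply: eq_bigr => i _; ring.
Qed.

Lemma sepquad_taylor {R : realType} {n : nat} (a b : 'I_n -> R) (c : R)
    (m y : 'I_n -> R) :
  sepquad a b c y =
  \sum_i (a i * (y i - m i) ^+ 2 + 2 * (a i * m i + b i) * (y i - m i))
  + sepquad a b c m.
Proof.
rewrite /sepquad addrA -big_split /=.
by congr (_ + _); apply: eq_bigr => i _; ring.
Qed.

Lemma sepquad_line {R : realType} {n : nat} (a b : 'I_n -> R) (c : R)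
    (m : 'I_n -> R) (i : 'I_n) (u : R) :
  sepquad a b c (fun j => m j + (if j == i then u else 0)) =
  a i * u ^+ 2 + 2 * (a i * m i + b i) * u + sepquad a b c m.
Proof.
rewrite (sepquad_taylor a b c m) (bigD1 i) //= eqxx big1 ?addr0.
  by rewrite addrC (addrC (m i)) addrK addrC.
by move=> j /negPf ->; ring.
Qed.

Lemma quad_ge0 {R : realFieldType} (a b c : R) :
  (forall u, 0 <= a * u ^+ 2 + 2 * b * u + c) -> 0 <= a /\ (a = 0 -> b = 0).
Proof.
move=> q_ge0.
have a_ge0 : 0 <= a.
  rewrite leNgt; apply/negP => a_lt0.
  (* Adding the values at [s] and [- s] cancels the linear term, and [s] is large enough to make the
     sum negative. *)
  set s := (`|b| + `|c| + 1) / - a + 1.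
  have s1 : 1 <= s by rewrite lerDr divr_ge0 // ?oppr_ge0 ?(ltW a_lt0).
  have asE : a * s = a - (`|b| + `|c| + 1) by rewrite /s; field; lra.
  have := q_ge0 s; have := q_ge0 (- s).
  have : c <= `|c| by rewrite ler_norm.
  have := normr_ge0 b; have := normr_ge0 c.
  rewrite sqrrN expr2 mulrA asE; nra.
split=> // a0; apply/eqP/negPn/negP => b0.
have := q_ge0 (- (c + 1) / (2 * b)).
have -> : a * (- (c + 1) / (2 * b)) ^+ 2 + 2 * b * (- (c + 1) / (2 * b)) + c
   = - 1 by rewrite a0; field.
by rewrite ler0N1.
Qed.

(** If [h > 0], half of [h] absorbs the term in [a] for small [t], and completing the square leaves
    an error of order [t ^+ 2], at most [t * e]. If [h = 0], nothing absorbs a loss, hence the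
    assumption on [a] and [b]. *)
Lemma quad_perturb {R : realFieldType} (h a b e : R) :
  0 <= h -> (h = 0 -> 0 <= a /\ b = 0) -> 0 < e ->
  exists2 t0, 0 < t0 & forall t u, 0 < t <= t0 ->
    - (t * e) <= h * u ^+ 2 + t * (a * u ^+ 2 + 2 * b * u).
Proof.
rewrite le_eqVlt => /orP[/eqP h0|h0] hab e0.
  have [a0 b0] := hab (esym h0).
  exists 1 => // t u /andP[t0 _].
  rewrite -h0 b0; have := mulr_ge0 a0 (sqr_ge0 u).
  nra.
pose t1 := h / (2 * (`|a| + 1)).
pose t2 := h * e / (2 * b ^+ 2 + 1).
have b2 := sqr_ge0 b; have a0 := normr_ge0 a.
have t1_gt0 : 0 < t1 by apply: divr_gt0 => //; lra.
have t2_gt0 : 0 < t2 by rewrite divr_gt0 ?mulr_gt0 //; lra.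
exists (Num.min t1 t2) => [|t u]; first by rewrite lt_min t1_gt0.
rewrite le_min => /and3P[t0 tt1 tt2].
have {tt1} ta : - (h / 2) <= t * a.
  move: tt1; rewrite ler_pdivlMr; last lra.
  have Na : - a <= `|a| by rewrite -normrN ler_norm.
  move=> ?; have : t * (- a) <= t * `|a| by rewrite ler_wpM2l ?(ltW t0).
  nra.
have {tt2} tb : t * (2 * b ^+ 2) <= h * e.
  move: tt2; rewrite ler_pdivlMr; last lra.
  nra.
(* Complete the square after spending half of [h] on [t * a * u ^+ 2]. *)
have key : 0 <= h / 2 * u ^+ 2 + t * (2 * b * u) + t * e.
  rewrite -(pmulr_rge0 _ h0).
  have -> : h * (h / 2 * u ^+ 2 + t * (2 * b * u) + t * e) =
    (h * u + 2 * t * b) ^+ 2 / 2 + t * (h * e - t * (2 * b ^+ 2)) by field.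
  by rewrite addr_ge0 ?divr_ge0 ?sqr_ge0 ?mulr_ge0 ?subr_ge0 // ltW.
have := sqr_ge0 u; nra.
Qed.

(** * Perturbing a nonnegative quadratic *)

Lemma sepquad_perturb {R : realType} {n : nat} (h k a b : 'I_n -> R)
    (c e T : R) :
  (forall y, 0 <= sepquad h k c y) ->
  (forall y, sepquad h k c y = 0 -> 0 < sepquad a b e y) -> 0 < T ->
  exists t delta, [/\ 0 <= t <= T, 0 < delta &
    forall y, delta <= sepquad h k c y + t * sepquad a b e y].
Proof.
move=> h_ge0 g_gt0 T0.
(* A minimiser of [h] and, where [h] is flat, of [g] (or [0] when [a i = 0], as
   [/ 0 = 0]; then [b i = 0]). *)
pose m i := if h i == 0 then - b i / a i else - k i / h i.
have hk i : 0 <= h i /\ (h i = 0 -> k i = 0).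
  have [hi0 ki0] : 0 <= h i /\ (h i = 0 -> h i * m i + k i = 0).
    by apply: (@quad_ge0 _ _ _ (sepquad h k c m)) => u;
       rewrite -sepquad_line; apply: h_ge0.
  by split=> // hi; move: (ki0 hi); rewrite hi mul0r add0r.
have hm i : h i * m i + k i = 0.
  rewrite /m; case: eqVneq => [hi0|hi0]; last by field.
  by rewrite hi0 mul0r add0r; apply: (hk i).2.
have hE y : sepquad h k c y =
    \sum_i h i * (y i - m i) ^+ 2 + sepquad h k c m.
  rewrite (sepquad_taylor h k c m); congr (_ + _); apply: eq_bigr => i _.
  by rewrite hm; ring.
have := h_ge0 m; rewrite le_eqVlt => /orP[/eqP hm0|hm_gt0]; last first.
  exists 0, (sepquad h k c m); split=> // [|y]; first by rewrite lexx ltW.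
  rewrite mul0r addr0 (hE y) lerDr sumr_ge0 // => i _.
  by rewrite mulr_ge0 ?sqr_ge0 ?(hk i).1.
set g := sepquad a b e in g_gt0 *.
have gm_gt0 : 0 < g m by apply: g_gt0.
(* Along a coordinate with [h i = 0] the first quadratic stays zero, so [g] is positive on that
   whole line through [m]. *)
have ab i : h i = 0 -> 0 <= a i /\ a i * m i + b i = 0.
  move=> hi0; have [ai0 bi0] : 0 <= a i /\ (a i = 0 -> a i * m i + b i = 0).
    apply: (@quad_ge0 _ _ _ (g m)) => u; rewrite -sepquad_line; apply/ltW/g_gt0.
    by rewrite sepquad_line hm hi0 -hm0; ring.
  split=> //; case: (eqVneq (a i) 0) => [/bi0 //|ai_neq0].
  by rewrite /m hi0 eqxx; field.
(* The [n] coordinates then lose less than half of the gain [t * g m]; [n.+1] also covers dimension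
   zero. *)
pose eps := g m / (2 * n.+1%:R).
have eps_gt0 : 0 < eps by rewrite divr_gt0 ?mulr_gt0 ?ltr0n.
have /fin_all_exists2[t0 t0_gt0 t0P] : forall i, exists2 ti, 0 < ti &
    forall t u, 0 < t <= ti ->
    - (t * eps) <= h i * u ^+ 2 + t * (a i * u ^+ 2 + 2 * (a i * m i + b i) * u).
  by move=> i; apply: quad_perturb; [exact: (hk i).1|exact: ab|].
pose t := \big[Num.min/T]_i t0 i.
have t_gt0 : 0 < t by apply: lt_bigmin.
exists t, (t * (g m / 2)); split; first by rewrite ltW // bigmin_le_id.
  by rewrite mulr_gt0 ?divr_gt0.
move=> y; rewrite hE -hm0 addr0 /g (sepquad_taylor a b e m y) -/(g m) mulrDr addrA.
rewrite mulr_sumr -big_split /=.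
have lb : \sum_(i < n) - (t * eps) <= \sum_(i < n) (h i * (y i - m i) ^+ 2 +
    t * (a i * (y i - m i) ^+ 2 + 2 * (a i * m i + b i) * (y i - m i))).
  by apply: ler_sum => i _; apply: t0P; rewrite t_gt0 bigmin_le.
rewrite sumr_const card_ord -[_ *+ n]mulr_natr in lb.
have n_ge0 : 0 <= n%:R :> R by apply: ler0n.
have -> : g m = eps * (2 * (n%:R + 1)) by rewrite natr1 divfK ?mulf_neq0 ?pnatr_eq0.
have := mulr_gt0 t_gt0 eps_gt0; nra.
Qed.

(** * Joint convexity and multipliers *)

(* Used with [v] the variance of a two-point distribution and [u] the offset from
   its mean of a point where neither quadratic exceeds its average.  If [a != 0], the equation
   [a * (u ^+ 2 - v) + 2 * p * u = 0] has one root of each sign, at which the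
   second expression is linear in [u]. *)
Lemma quad_pair_spread {R : rcfType} (a p b q v : R) : 0 <= v ->
  exists u, a * (u ^+ 2 - v) + 2 * p * u <= 0 /\
            b * (u ^+ 2 - v) + 2 * q * u <= 0.
Proof.
have main (a' p' b' q' : R) : 0 <= v -> a' != 0 ->
    exists u, a' * (u ^+ 2 - v) + 2 * p' * u <= 0 /\
              b' * (u ^+ 2 - v) + 2 * q' * u <= 0.
  move=> v0 a0; set k := p' / a'; set s := Num.sqrt (k ^+ 2 + v).
  have s2 : s ^+ 2 = k ^+ 2 + v by rewrite sqr_sqrtr // addr_ge0 ?sqr_ge0.
  have ks : `|k| <= s by rewrite -sqrtr_sqr ler_wsqrtr // lerDl.
  have := ler_norm k; have := ler_norm (- k); rewrite normrN => k1 k2.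
  have pE : p' = a' * k by rewrite /k; field.
  have root u : (u + k) ^+ 2 = s ^+ 2 -> u ^+ 2 - v = - (2 * k * u).
    by rewrite s2 => /eqP; rewrite -subr_eq0 => /eqP E; apply/eqP;
       rewrite -subr_eq0 -E; apply/eqP; ring.
  (* At either root the second expression is [2 * (q' - b' * k) * u], so this sign selects the
     root. *)
  have [c0|c0] := lerP (q' - b' * k) 0.
    exists (s - k); rewrite (root (s - k)) ?subrK // pE; split; nra.
  exists (- s - k); rewrite (root (- s - k)) ?subrK ?sqrrN // pE; split; nra.
move=> v0.
have [a0|a0] := eqVneq a 0; last exact: main.
have [b0|b0] := eqVneq b 0; last by have [u [? ?]] := main b q a p v0 b0; exists u.
by exists 0; rewrite a0 b0; split; nra.
Qed.

(** In each coordinate, the average of a quadratic over two points is its value at the mean plus its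
    leading coefficient times the variance; one offset from the mean serves both quadratics. *)
Lemma sepquad_pair_convex {R : realType} {n : nat} (a p b q : 'I_n -> R)
    (c e : R) (x y : 'I_n -> R) (l : R) : 0 <= l <= 1 ->
  exists z,
    sepquad a p c z <= l * sepquad a p c x + (1 - l) * sepquad a p c y /\
    sepquad b q e z <= l * sepquad b q e x + (1 - l) * sepquad b q e y.
Proof.
move=> /andP[l0 l1].
have /fin_all_exists[z zP] : forall i, exists r,
   a i * r ^+ 2 + 2 * p i * r <= l * (a i * x i ^+ 2 + 2 * p i * x i)
      + (1 - l) * (a i * y i ^+ 2 + 2 * p i * y i) /\
   b i * r ^+ 2 + 2 * q i * r <= l * (b i * x i ^+ 2 + 2 * q i * x i)
      + (1 - l) * (b i * y i ^+ 2 + 2 * q i * y i).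
  move=> i; pose m := l * x i + (1 - l) * y i.
  have [|u [ua ub]] := quad_pair_spread (a i) (a i * m + p i) (b i)
    (b i * m + q i) (l * (1 - l) * (x i - y i) ^+ 2).
    by rewrite mulr_ge0 ?sqr_ge0 // mulr_ge0 // subr_ge0.
  exists (m + u); split; rewrite -subr_le0; [move: ua|move: ub];
    by apply: le_trans; rewrite le_eqVlt; apply/orP; left; apply/eqP;
       rewrite /m; ring.
exists z; split.
  have -> : l * sepquad a p c x + (1 - l) * sepquad a p c y =
    l * (sepquad a p c x - c) + (1 - l) * (sepquad a p c y - c) + c by ring.
  rewrite /sepquad !addrK lerD2r !mulr_sumr -big_split ler_sum // => i _.
  exact: (zP i).1.
have -> : l * sepquad b q e x + (1 - l) * sepquad b q e y =
  l * (sepquad b q e x - e) + (1 - l) * (sepquad b q e y - e) + e by ring.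
rewrite /sepquad !addrK lerD2r !mulr_sumr -big_split ler_sum // => i _.
exact: (zP i).2.
Qed.

(** Convexity of the set of pairs dominating some [(f z, g z)] in both entries. *)
Definition pair_convex {R : numDomainType} {T : Type} (f g : T -> R) :=
  forall x y l, 0 <= l <= 1 ->
  exists z, f z <= l * f x + (1 - l) * f y /\ g z <= l * g x + (1 - l) * g y.

(** Weights making the average of [g] zero give a feasible [z], where [f] is positive. Divided by
    [- g x * g y], the conclusion reads [- f y / g y < f x / - g x]. *)
Lemma pair_convex_cross {R : realFieldType} {T : Type} (f g : T -> R) :
  pair_convex f g -> (forall x, g x <= 0 -> 0 < f x) ->
  forall x y, g x < 0 < g y -> 0 < f x * g y - f y * g x.
Proof.
move=> fg_cvx f_gt0 x y /andP[gx gy].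
have D_gt0 : 0 < g y - g x by lra.
have [|z [fz gz]] := fg_cvx x y (g y / (g y - g x)).
  by apply/andP; split; [apply: divr_ge0; lra|rewrite ler_pdivrMr //; lra].
have {}gz : g z <= 0.
  by apply: le_trans gz _; rewrite le_eqVlt; apply/orP; left; apply/eqP; field; lra.
have {f_gt0} := lt_le_trans (f_gt0 _ gz) fz.
rewrite -(pmulr_rgt0 _ D_gt0) => H; suff -> : f x * g y - f y * g x =
  (g y - g x) * (g y / (g y - g x) * f x + (1 - g y / (g y - g x)) * f y) by [].
by field; lra.
Qed.

(** Points with [g > 0] bound [eta] from below, those with [g < 0] from above, and every lower bound
    lies below every upper one; the supremum of the lower bounds works. *)
Lemma pair_convex_multiplier {R : realType} {T : Type} (f g : T -> R) :
  pair_convex f g -> (forall x, g x <= 0 -> 0 < f x) ->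
  (exists x, g x < 0) ->
  exists2 eta, 0 <= eta & forall x, 0 <= f x + eta * g x.
Proof.
move=> fg_cvx f_gt0 [x0 gx0].
have cross := pair_convex_cross f g fg_cvx f_gt0.
(* Including 0 makes [S] nonempty and its supremum nonnegative. *)
pose S := [set s | s = 0 \/ exists2 y, 0 < g y & s = - f y / g y].
have S_ub x : g x < 0 -> ubound S (f x / - g x).
  move=> gx s [->|[y gy ->]].
    by apply: divr_ge0; [apply/ltW/f_gt0/ltW|rewrite oppr_ge0 ltW].
  rewrite ler_pdivrMr // mulrAC ler_pdivlMr ?oppr_gt0 //.
  by have := cross x y; rewrite gx gy => /(_ isT); lra.
have S_bd : has_ubound S by exists (f x0 / - g x0); apply: S_ub.
have S_ne : S !=set0 by exists 0; left.
exists (sup S) => [|x]; first by apply: ub_le_sup => //; left.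
have [gx|gx|gx] := ltrgtP (g x) 0.
- have := ge_sup S_ne (S_ub x gx).
  by rewrite ler_pdivlMr ?oppr_gt0 //; lra.
- have : - f x / g x <= sup S by apply: ub_le_sup => //; right; exists x.
  by rewrite ler_pdivrMr //; lra.
- by rewrite gx mulr0 addr0 ltW // f_gt0 // gx.
Qed.

Lemma sepquad_strict_multiplier {R : realType} {n : nat} (a p b q : 'I_n -> R)
    (c e : R) :
  let f := sepquad a p c in let g := sepquad b q e in
  (forall y, g y <= 0 -> 0 < f y) -> (exists y, g y < 0) ->
  exists delta eta, [/\ 0 < delta, 0 <= eta & forall y, delta <= f y + eta * g y].
Proof.
move=> f g f_gt0 slater.
have fg_cvx : pair_convex f g by move=> x y l; apply: sepquad_pair_convex.
have [eta eta0 h_ge0] := pair_convex_multiplier f g fg_cvx f_gt0 slater.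
have cross := pair_convex_cross f g fg_cvx f_gt0.
pose a' i := a i + eta * b i; pose p' i := p i + eta * q i.
have hE y : sepquad a' p' (c + eta * e) y = f y + eta * g y by rewrite sepquadD.
have h'_ge0 y : 0 <= sepquad a' p' (c + eta * e) y by rewrite hE.
(* If [g] is positive on the zeros of [f + eta * g], the multiplier is raised. *)
have [g_gt0|] := pselect (forall y, f y + eta * g y = 0 -> 0 < g y).
  have [||t [delta [/andP[t0 _] delta0 lb]]] :=
    sepquad_perturb a' p' b q (c + eta * e) e 1 h'_ge0 _ _ => //.
    by move=> y; rewrite hE; apply: g_gt0.
  exists delta, (eta + t); split; rewrite ?addr_ge0 // => y.
  by have := lb y; rewrite hE -/(g y) mulrDl addrA.
move=> /existsNP[y0 /not_implyP[hy0 /negP]]; rewrite -leNgt => gy0.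
have fy0 := f_gt0 _ gy0.
have eta_gt0 : 0 < eta.
  by rewrite lt_neqAle eta0 andbT; apply/eqP => E; move: hy0; rewrite -E; lra.
have {}gy0 : g y0 < 0 by nra.
(* At two zeros with opposite signs of [g], [f = - eta * g] would make the expression in [cross]
   vanish. *)
have g_lt0 y : f y + eta * g y = 0 -> g y < 0.
  move=> hy; rewrite ltNge le_eqVlt; apply/negP => /orP[/eqP gy|gy].
    by have := f_gt0 y; rewrite -gy => /(_ (lexx 0)); move: hy; rewrite -gy; lra.
  have := cross y0 y; rewrite gy0 gy => /(_ isT).
  have -> : f y = - (eta * g y) by lra.
  have -> : f y0 = - (eta * g y0) by lra.
  by rewrite [_ - _](_ : _ = 0) ?ltxx //; ring.
(* Perturbing by [- g] lowers the multiplier; the cap [eta] keeps it nonnegative. *)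
have [||t [delta [/andP[t0 teta] delta0 lb]]] := sepquad_perturb a' p'
  (fun i => - b i) (fun i => - q i) (c + eta * e) (- e) eta h'_ge0 _ _ => //.
  by move=> y; rewrite hE sepquadN oppr_gt0; apply: g_lt0.
exists delta, (eta - t); split; rewrite ?subr_ge0 // => y.
by have := lb y; rewrite hE sepquadN -/(g y) mulrN mulrBl addrA.
Qed.

(** * Matrices and bordered forms *)

Lemma quadfun_diag {R : realType} {n : nat} (A C : 'M[R]_n) (D : 'rV[R]_n)
    (b : 'cV[R]_n) (c : R) (y : 'cV[R]_n) : C^T *m A *m C = diag_mx D ->
  quadfun A b c (C *m y) =
  sepquad (D 0) (fun i => (C^T *m b) i 0) c (fun i => y i 0).
Proof.
move=> CAC; rewrite /quadfun /sepquad.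
have -> : (C *m y)^T *m A *m (C *m y) = y^T *m diag_mx D *m y.
  by rewrite -CAC trmx_mul !mulmxA.
have -> : b^T *m (C *m y) = (C^T *m b)^T *m y by rewrite trmx_mul trmxK mulmxA.
rewrite !mxE mulr_sumr -big_split /=; congr (_ + _); apply: eq_bigr => i _.
by rewrite mul_mx_diag !mxE; ring.
Qed.

Lemma quadfunD {R : realType} {n : nat} (A B : 'M[R]_n) (b d : 'cV[R]_n)
    (c e t : R) (x : 'cV[R]_n) :
  quadfun (A + t *: B) (b + t *: d) (c + t * e) x =
  quadfun A b c x + t * quadfun B d e x.
Proof.
rewrite /quadfun mulmxDr mulmxDl [(b + _)^T]linearD /=.
rewrite [(t *: d)^T]linearZ /= mulmxDl -scalemxAr -!scalemxAl.
move: (x^T *m A *m x) (x^T *m B *m x) (b^T *m x) (d^T *m x) => p q r s.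
by rewrite !mxE; ring.
Qed.

Lemma bordermxD {R : realType} {n : nat} (A B : 'M[R]_n) (b d : 'cV[R]_n)
    (c e t : R) :
  bordermx A b c + t *: bordermx B d e =
  bordermx (A + t *: B) (b + t *: d) (c + t * e).
Proof.
rewrite /bordermx scale_block_mx add_block_mx linearD linearZ /=.
by rewrite scale_scalar_mx -raddfD.
Qed.

Lemma bordermx_form {R : realType} {n : nat} (A : 'M[R]_n) (b : 'cV[R]_n)
    (c s : R) (x : 'cV[R]_n) :
  ((col_mx x s%:M)^T *m bordermx A b c *m col_mx x s%:M) 0 0 =
  (x^T *m A *m x) 0 0 + 2 * s * (b^T *m x) 0 0 + c * s ^+ 2.
Proof.
rewrite tr_col_mx /bordermx mul_row_block mul_row_col !mulmxDl tr_scalar_mx.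
rewrite !mul_scalar_mx !mul_mx_scalar -scalemxAl scale_scalar_mx.
have -> : x^T *m b = b^T *m x.
  by rewrite [LHS]mx11_scalar -tr_scalar_mx -mx11_scalar trmx_mul trmxK.
by rewrite !mxE /= mulr1n; ring.
Qed.

Lemma symmetricmxE {R : realType} {n : nat} (A : 'M[R]_n) :
  (A \is symmetricmx) = (A == A^T).
Proof. by rewrite is_hermitianmxE expr0 scale1r map_mx_id. Qed.

(** With last coordinate [s != 0], the bordered form is [s ^+ 2] times the quadratic at [s^-1 *: x];
    with [s = 0], it is the leading coefficient of the quadratic along [u *: x]. *)
Lemma psdmx_bordermx {R : realType} {n : nat} (A : 'M[R]_n) (b : 'cV[R]_n)
    (c : R) : A \is symmetricmx ->
  psdmx (bordermx A b c) <-> forall x, 0 <= quadfun A b c x.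
Proof.
move=> symA; split=> [[_ psd] x|q_ge0].
  by have := psd (col_mx x 1%:M); rewrite bordermx_form mulr1 expr1n mulr1.
split.
  rewrite symmetricmxE in symA.
  by rewrite symmetricmxE /bordermx tr_block_mx -(eqP symA) trmxK tr_scalar_mx.
move=> z; rewrite -(vsubmxK z) [dsubmx z]mx11_scalar.
move: (usubmx z) (dsubmx z 0 0) => x s; rewrite bordermx_form.
have [->|s0] := eqVneq s 0.
  have [H _] : 0 <= (x^T *m A *m x) 0 0 /\
      ((x^T *m A *m x) 0 0 = 0 -> (b^T *m x) 0 0 = 0).
    apply: (@quad_ge0 _ _ _ c) => u; have := q_ge0 (u *: x).
    rewrite /quadfun [(u *: x)^T]linearZ /= -!scalemxAl -!scalemxAr.
    move: (x^T *m A *m x) (b^T *m x) => P Q; rewrite !mxE.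
    by move=> H; apply: le_trans H _; rewrite le_eqVlt;
       apply/orP; left; apply/eqP; ring.
  by rewrite expr0n /= !mulr0 mul0r !addr0.
have := mulr_ge0 (sqr_ge0 s) (q_ge0 (s^-1 *: x)).
rewrite /quadfun [(s^-1 *: x)^T]linearZ /= -!scalemxAl -!scalemxAr.
move: (x^T *m A *m x) (b^T *m x) => P Q; rewrite !mxE.
by move=> H; apply: le_trans H _; rewrite le_eqVlt;
   apply/orP; left; apply/eqP; field.
Qed.

Theorem theorem4p2 (R : realType) (n : nat)
    (A2 B : 'M[R]_n) (b2 d : 'cV[R]_n) (c2 alpha : R)
    (symA2 : A2 \is symmetricmx) (symB : B \is symmetricmx)
    (sdcAB : sim_diag_congr A2 B)
    (slater : exists xbar : 'cV[R]_n, quadfun B d alpha xbar < 0) :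
  let f2 := quadfun A2 b2 c2 in
  let g := quadfun B d alpha in
  let X := [set x : 'cV[R]_n | g x <= 0] in
  let a := forall x : 'cV[R]_n, X x -> 0 < f2 x in
  let b := exists delta eta : R, [/\ 0 < delta, 0 <= eta &
    psdmx (bordermx A2 b2 (c2 - delta) + eta *: bordermx B d alpha)] in
  let c := exists delta : R, 0 < delta /\
    (delta%:E <= ereal_inf [set (f2 x)%:E | x in X])%E in
  (a <-> b) /\ (b <-> c).
Proof.
move=> f2 g X a b c.
(* The matrix inequality in (b) becomes a uniform lower bound on [f2 + eta * g]. *)
have psdP delta eta :
    psdmx (bordermx A2 b2 (c2 - delta) + eta *: bordermx B d alpha) <->
    forall x, delta <= f2 x + eta * g x.
  have sym : A2 + eta *: B \is symmetricmx.
    move: symA2 symB; rewrite !symmetricmxE => /eqP sA /eqP sB.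
    by rewrite linearD linearZ /= -sA -sB.
  have shift x : quadfun A2 b2 (c2 - delta) x = f2 x - delta.
    by rewrite /f2 /quadfun addrA.
  rewrite bordermxD; apply: iff_trans (psdmx_bordermx _ _ _ sym) _.
  by split=> H x; have := H x; rewrite quadfunD shift (addrAC (f2 x)) subr_ge0.
have bc : b -> c.
  move=> [delta [eta [delta0 eta0 /psdP lb]]]; exists delta; split=> //.
  apply: le_ereal_inf_tmp => _ [x gx <-]; rewrite lee_fin.
  by apply: le_trans (lb x) _; rewrite gerDl mulr_ge0_le0.
have ca : c -> a.
  move=> [delta [delta0 lb]] x gx; apply: lt_le_trans delta0 _; rewrite -lee_fin.
  by apply: le_trans lb _; apply: ereal_inf_lbound; exists x.
suff ab : a -> b.
  by split; [split=> [/ab|/bc/ca]|split=> [/bc|/ca/ab]].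
move=> f_gt0; have [C [uC /diag_mxP[DA EA] /diag_mxP[DB EB]]] := sdcAB.
pose f' := sepquad (DA 0) (fun i => (C^T *m b2) i 0) c2.
pose g' := sepquad (DB 0) (fun i => (C^T *m d) i 0) alpha.
have fE y : f' y = f2 (C *m \col_i y i).
  rewrite /f2 (quadfun_diag _ _ _ _ _ _ EA); congr sepquad.
  by apply/funext => i; rewrite mxE.
have gE y : g' y = g (C *m \col_i y i).
  rewrite /g (quadfun_diag _ _ _ _ _ _ EB); congr sepquad.
  by apply/funext => i; rewrite mxE.
have surj x : C *m \col_i (invmx C *m x) i 0 = x.
  rewrite [\col_i _](_ : _ = invmx C *m x) ?mulKVmx //.
  by apply/colP => i; rewrite mxE.
have [||delta [eta [delta0 eta0 lb]]] := sepquad_strict_multiplier (DA 0)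
  (fun i => (C^T *m b2) i 0) (DB 0) (fun i => (C^T *m d) i 0) c2 alpha.
- by move=> y; rewrite -/(f' y) -/(g' y) fE gE; apply: f_gt0.
- have [x gx] := slater; exists (fun i => (invmx C *m x) i 0).
  by rewrite -/(g' _) gE surj.
exists delta, eta; split=> //; apply/psdP => x.
by have := lb (fun i => (invmx C *m x) i 0); rewrite -/(f' _) -/(g' _) fE gE surj.
Qed.
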